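(* Let $q\ge p>1$ and let $T:A^p_v\to A^q_v$ be a bounded linear operator. Then at least one of the following holds: (1) There exists a sequence $(f_n)_n$ of unit vectors in $A^p_v$ such that $f_n\to0$ weakly (equivalently, in the topology of compact convergence, i.e. uniformly on compact subsets of $\mathbb D$) and $\lim_{n\to\infty}\|T(f_n)\|_{A^q_v}=\|T\|_{A^p_v\to A^q_v}$. (2) There exists a function $f$ in the closed unit ball of $A^p_v$ such that $\|T(f)\|_{A^q_v}=\|T\|_{A^p_v\to A^q_v}$.
   Context: $\mathbb D$ is the open unit disk, $dA$ Lebesgue area measure. $v:\mathbb D\to(0,\infty)$ is continuous and radial ($v(z)=v(|z|)$) with $\int_{\mathbb D}v\,\frac{dA}{\pi}=1$. For $1<p<\infty$, $A^p_v$ is the space of analytic $f$ on $\mathbb D$ with $\|f\|_{A^p_v}^p=\int_{\mathbb D}|f|^pv\,\frac{dA}{\pi}<\infty$. Standing assumptions on the spaces $A^p_v$ (and $A^q_v$): point evaluations $\delta_z:f\mapsto f(z)$, $z\in\mathbb D$, are bounded, $\int_0^1\|\delta_s\|_{(A^p_v)^*}\,ds<\infty$, and the space is reflexive. *)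

(* Defs.v *)
From HB Require Import structures.
From mathcomp Require Import all_boot all_order all_algebra.
From mathcomp Require Import all_classical all_reals all_analysis.
From mathcomp Require Import measurable_realfun complex.

Set Implicit Arguments.
Unset Strict Implicit.
Unset Printing Implicit Defensive.
Import Order.TTheory GRing.Theory Num.Theory numFieldNormedType.Exports.

Local Open Scope classical_set_scope.
Local Open Scope ring_scope.
Local Open Scope complex_scope.

HB.instance Definition _ (R : realType) := NormedModule.copy R[i] R[i]^o.

(* Norms of normed modules over R[i] take their values in R[i]; [rnorm] is the
   same number as an element of R. *)
Definition rnorm (R : realType) (V : normedModType R[i]) (x : V) : R :=
  complex.Re `|x|.

Section linear_functional_analysis.
Variable R : realType.

Definition opnorm (V W : normedModType R[i]) (F : V -> W) : \bar R :=
  ereal_sup [set (rnorm (F x))%:E | x in [set x | rnorm x <= 1]].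

Definition dual (V : normedModType R[i]) : set (V -> R[i]) :=
  [set phi | linear phi /\ (opnorm phi < +oo)%E].

Definition weak_cvg (V : normedModType R[i]) (u : nat -> V) (x : V) : Prop :=
  forall phi, dual phi -> phi (u n) @[n --> \oo] --> phi x.

(* Surjectivity of the canonical embedding into the bidual.  An element [Psi] of
   the bidual is a map which is only constrained on [dual]. *)
Definition reflexive_space (V : normedModType R[i]) : Prop :=
  forall Psi : (V -> R[i]) -> R[i],
    (forall a phi psi, dual phi -> dual psi ->
      Psi (a *: phi + psi) = a * Psi phi + Psi psi) ->
    (exists M : R, forall phi, dual phi ->
      ((rnorm (Psi phi))%:E <= M%:E * opnorm phi)%E) ->
    exists x : V, forall phi, dual phi -> Psi phi = phi x.

End linear_functional_analysis.

Section disk.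
Variable R : realType.

Definition disk : set R[i] := [set z | `|z| < 1].

Definition toC (w : R * R) : R[i] := w.1 +i* w.2.

Definition diskR2 : set (R * R) := [set w | disk (toC w)].

Definition area := (@lebesgue_measure R \x @lebesgue_measure R)%E.

(* The topology of compact convergence on the disk. *)
Definition compact_cvg (u : nat -> R[i] -> R[i]) (f : R[i] -> R[i]) : Prop :=
  {family (fun K : set R[i] => compact K /\ K `<=` disk), u @ \oo --> f}.

(* Only the values on [disk] matter. *)
Record weight := Weight {
  wfun :> R[i] -> R ;
  wfun_gt0 : forall z, disk z -> 0 < wfun z ;
  wfun_continuous : forall z, disk z -> {for z, continuous wfun} ;
  wfun_radial : forall z, disk z -> wfun z = wfun `|z| ;
  wfun_int : (\int[area]_(w in diskR2) (wfun (toC w) / pi)%:E = 1)%E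
}.

End disk.

Section bergman_space.
Variable R : realType.
Implicit Types (v : weight R) (p : R) (f : R[i] -> R[i]).

Definition pintegral v p f : \bar R :=
  (\int[@area R]_(w in @diskR2 R)
     (rnorm (f (toC w)) `^ p * v (toC w) / pi)%:E)%E.

(* A function on the disk is encoded as a function on R[i] which vanishes
   outside of the disk; analyticity is complex differentiability. *)
Definition bergman_set v p : set (R[i] -> R[i]) :=
  [set f | [/\ forall z, disk z -> derivable f z 1,
               forall z, ~ disk z -> f z = 0
             & (pintegral v p f < +oo)%E]].

Definition bergman_norm v p f : R := fine (pintegral v p f) `^ p^-1.

End bergman_space.

Section disk_lemmas.
Variable R : realType.

Lemma rnormE (V : normedModType R[i]) (x : V) : `|x| = (rnorm x)%:C.
Proof.
have := normr_ge0 x; rewrite /rnorm; case: `|x| => a b.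
by rewrite lecE /= => /andP[/eqP -> _].
Qed.

Lemma rnorm_ge0 (V : normedModType R[i]) (x : V) : 0 <= rnorm x.
Proof. by rewrite -ler0c -rnormE. Qed.

Lemma rnormD (V : normedModType R[i]) (x y : V) :
  rnorm (x + y) <= rnorm x + rnorm y.
Proof. by rewrite -lecR rmorphD /= -!rnormE ler_normD. Qed.

Lemma rnormZ (V : normedModType R[i]) (a : R[i]) (x : V) :
  rnorm (a *: x) = rnorm a * rnorm x.
Proof.
by apply: (@complexI R); rewrite rmorphM /= -!rnormE normrZ.
Qed.

Lemma rnorm_eq0 (V : normedModType R[i]) (x : V) : rnorm x = 0 -> x = 0.
Proof. by move=> x0; apply/normr0_eq0; rewrite rnormE x0. Qed.

Lemma rnorm0 (V : normedModType R[i]) : rnorm (0 : V) = 0.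
Proof. by rewrite /rnorm normr0. Qed.

Lemma rnorm_continuous (V : normedModType R[i]) : continuous (@rnorm R V).
Proof.
move=> x; apply/cvgrPdist_lt => e e0.
have e0C : 0 < e%:C by rewrite ltcR.
have := @cvg_id _ (nbhs x); move=> /cvgrPdist_lt/(_ _ e0C).
apply: filterS => y; rewrite rnormE ltcR; apply: le_lt_trans.
have h (a b : V) : rnorm a - rnorm b <= rnorm (a - b).
  by rewrite lerBlDr; apply: le_trans (rnormD _ _); rewrite subrK.
rewrite ler_norml h andbT lerNl opprB; apply: le_trans (h _ _) _.
by rewrite /rnorm distrC.
Qed.

Lemma disk_open : open (@disk R).
Proof.
have -> : @disk R = ball (0:R[i]) 1.
  by apply/seteqP; split=> z; rewrite /disk /= -ball_normE /= sub0r normrN.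
exact: ball_open.
Qed.

Lemma open_toC_square (U : set R[i]) (w : R * R) : open U -> U (toC w) ->
  exists2 r : R, 0 < r &
    forall w', `|w.1 - w'.1| < r -> `|w.2 - w'.2| < r -> U (toC w').
Proof.
move=> oU Uw.
have /nbhs_ballP[e /= e0 eU] : nbhs (toC w) U by exact: open_nbhs_nbhs.
have [r r0 re] : exists2 r : R, 0 < r & e = r%:C.
  move: e0; case: (e) => a b; rewrite ltcE /= => /andP[/eqP -> a0].
  by exists a.
exists (r / 2); first by rewrite divr_gt0.
case: w {Uw} eU => x y eU [x' y'] /= hx hy.
apply: eU; rewrite -ball_normE /= re /toC /=.
have -> : (x +i* y) - (x' +i* y') = (x - x')%:C + 'i * (y - y')%:C by simpc.
apply: le_lt_trans (ler_normD _ _) _.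
rewrite normrM !normc_def /= !expr0n /= expr1n addr0 add0r sqrtr1 mul1r addr0.
rewrite !sqrtr_sqr -rmorphD /= ltcR [ltRHS]splitr.
exact: ltrD.
Qed.

Lemma open_toC_measurable (U : set R[i]) :
  open U -> measurable (@toC R @^-1` U).
Proof.
move=> oU.
pose Q (t : rat * rat * nat) : set (R * R) :=
  `](ratr t.1.1 - t.2.+1%:R^-1), (ratr t.1.1 + t.2.+1%:R^-1)[%classic `*`
  `](ratr t.1.2 - t.2.+1%:R^-1), (ratr t.1.2 + t.2.+1%:R^-1)[%classic.
have -> : @toC R @^-1` U =
    \bigcup_t (if `[< Q t `<=` @toC R @^-1` U >] then Q t else set0).
  apply/seteqP; split => [[x y] /= Uw|w [t _]]; last first.
    by case: asboolP => // + Qw; exact.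
  have [r r0 rU] := open_toC_square oU Uw.
  have [n nr] : exists n : nat, 2 * n.+1%:R^-1 < r.
    have r20 : 0 < r / 2 by rewrite divr_gt0.
    have [n _ /(_ n (leqnn n))] := near_infty_natSinv_lt (PosNum r20) => /= h.
    by exists n; rewrite mulrC -ltr_pdivlMr.
  have : 0 < n.+1%:R^-1 :> R by rewrite invr_gt0.
  move: nr; rewrite /Q; move EN : (n.+1%:R^-1) => N nr n0.
  have ratnear (z : R) : exists a : rat, ratr a \in `](z - N), (z + N)[.
    by apply: rat_in_itvoo; rewrite ltrD2l gtrN.
  have [a] := ratnear x; have [b] := ratnear y.
  rewrite !in_itv /= => /andP[b1 b2] /andP[a1 a2].
  exists (a, b, n) => //=; case: asboolP => [_|].
    rewrite /= EN !in_itv /=.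
    by rewrite ltrBlDr a2 -ltrBlDr a1 ltrBlDr b2 -ltrBlDr b1.
  case=> -[x' y']; rewrite /= EN !in_itv /= => -[/andP[x1 x2] /andP[y1 y2]].
  have close (c c' s : R) : c - N < s -> s < c + N -> s - N < c' ->
      c' < s + N -> `|c - c'| < r.
    move=> h1 h2 h3 h4; apply: lt_trans nr; rewrite mulr_natl mulr2n.
    apply: le_lt_trans (ler_distD s _ _) _.
    by apply: ltrD; rewrite ltr_distl ltrBlDr ?h2 ?h4 -ltrBlDr ?h1 ?h3.
  by apply: rU => /=; [apply: (close _ _ (ratr a))|apply: (close _ _ (ratr b))].
apply: countable_bigcupT_measurable => //= t; case: ifP => // _.
by apply: measurableX; exact: measurable_itv.
Qed.

Lemma area_open_gt0 (U : set R[i]) (w : R * R) : open U -> U (toC w) ->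
  (0 < @area R (@toC R @^-1` U))%E.
Proof.
move=> oU Uw; have [r r0 rU] := open_toC_square oU Uw.
pose S : set (R * R) := `](w.1 - r), (w.1 + r)[%classic `*`
  `](w.2 - r), (w.2 + r)[%classic.
have SU : S `<=` @toC R @^-1` U.
  move=> w' [] /=; rewrite !in_itv /= => /andP[a1 a2] /andP[b1 b2].
  by apply: rU; rewrite distrC ltr_distl ?a1 ?b1.
apply: (@lt_le_trans _ _ (@area R S)); last first.
  apply: le_measure => //; rewrite inE; last exact: open_toC_measurable.
  by apply: measurableX; exact: measurable_itv.
rewrite /area product_measure1E; [|exact: measurable_itv..].
have h (c : R) : (0 < @lebesgue_measure R `](c - r)%R, (c + r)%R[%classic)%E.
  rewrite lebesgue_measure_itv /= lte_fin ltrD2l gtrN // -EFinD lte_fin.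
  by rewrite subr_gt0 ltrD2l gtrN.
exact: mule_gt0 (h _) (h _).
Qed.

Lemma measurable_diskR2 : measurable (@diskR2 R).
Proof. exact: open_toC_measurable disk_open. Qed.

Lemma measurable_toC_continuous (h : R[i] -> R) :
  (forall z, disk z -> {for z, continuous h}) ->
  measurable_fun (@diskR2 R) (h \o @toC R).
Proof.
move=> ch; apply: (measurability _ (RGenOInfty.measurableE R)) => //=.
move=> _ [_ [a ->] <-].
have -> : @diskR2 R `&` (h \o @toC R) @^-1` `]a, +oo[ =
    @toC R @^-1` (disk (R := R) `&` h @^-1` `]a, +oo[) by [].
apply: open_toC_measurable.
rewrite openE => z [Dz] /= ha; apply: filterI.
  by apply: open_nbhs_nbhs; split => //; exact: disk_open.
by apply: (ch z Dz); apply: open_nbhs_nbhs; split.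
Qed.

End disk_lemmas.

Section bergman_lemmas.
Variables (R : realType) (v : weight R) (p : R).
Hypothesis p1 : 1 < p.
Implicit Types f g : R[i] -> R[i].

Let p0 : 0 < p. Proof. exact: lt_trans p1. Qed.

Local Notation bergman_norm := (bergman_norm v p).

Let dens (w : R * R) : R := (v (toC w) / pi) `^ p^-1.

Let mass f : R * R -> R :=
  (fun w => rnorm (f (toC w)) * dens w) \_ (@diskR2 R).

Let dens_gt0 w : diskR2 w -> 0 < dens w.
Proof. by move=> Dw; rewrite powR_gt0 // divr_gt0 ?pi_gt0 // wfun_gt0. Qed.

Let mass_ge0 f w : 0 <= mass f w.
Proof.
rewrite /mass patchE; case: ifPn => // _.
by rewrite mulr_ge0 ?rnorm_ge0 ?powR_ge0.
Qed.

Lemma bergman_continuous f z :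
  f \in bergman_set v p -> disk z -> {for z, continuous f}.
Proof.
move=> /set_mem[df _ _] Dz.
by apply: differentiable_continuous; apply/derivable1_diffP; exact: df.
Qed.

Let measurable_mass f : (forall z, disk z -> {for z, continuous f}) ->
  measurable_fun setT (mass f).
Proof.
move=> cf; apply: (proj1 (measurable_restrictT _ (@measurable_diskR2 R))).
apply: measurable_funM.
  apply: (measurable_toC_continuous (h := fun z => rnorm (f z))) => z Dz.
  apply: continuous_comp; first exact: cf.
  exact: rnorm_continuous.
apply: (measurableT_comp (f := fun x : R => x `^ p^-1)).
  exact: measurable_powR.
apply: measurable_funM; last exact: measurable_cst.
by apply: measurable_toC_continuous; exact: wfun_continuous.
Qed.

Let Lnorm_mass f :
  ('N[@area R]_p%:E[EFin \o mass f] = pintegral v p f `^ p^-1)%E.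
Proof.
rewrite unlock /Lnorm /pintegral [in RHS]integral_mkcond; congr (_ `^ _)%E.
apply: eq_integral => w _ /=; rewrite /mass !patchE.
case: ifPn => [|_]; last by rewrite normr0 powR0 // gt_eqF.
rewrite inE => Dw; rewrite ger0_norm ?mulr_ge0 ?rnorm_ge0 ?powR_ge0 //.
rewrite powRM ?rnorm_ge0 ?powR_ge0 // -powRrM mulVf ?gt_eqF // powRr1.
  by rewrite mulrA.
by rewrite divr_ge0 ?pi_ge0 // ltW // wfun_gt0.
Qed.

Lemma pintegral_ge0 f : (0 <= pintegral v p f)%E.
Proof.
apply: integral_ge0 => w Dw; rewrite lee_fin divr_ge0 ?pi_ge0 //.
by rewrite mulr_ge0 ?powR_ge0 // ltW // wfun_gt0.
Qed.

Lemma bergman_norm_ge0 f : 0 <= bergman_norm f.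
Proof. exact: powR_ge0. Qed.

Let bergman_normE f : f \in bergman_set v p ->
  ((bergman_norm f)%:E = 'N[@area R]_p%:E[EFin \o mass f])%E.
Proof.
move=> /set_mem[_ _ fy]; rewrite Lnorm_mass /bergman_norm -poweR_EFin fineK //.
by rewrite ge0_fin_numE // pintegral_ge0.
Qed.

Let pintegral_lty f :
  ('N[@area R]_p%:E[EFin \o mass f] < +oo)%E -> (pintegral v p f < +oo)%E.
Proof.
rewrite Lnorm_mass => h; have /(poweR_lty p) := h.
by rewrite -poweRrM mulVf ?gt_eqF // poweRe1 // pintegral_ge0.
Qed.

Let le_Lnorm_mass (g h : R * R -> R) :
  measurable_fun setT g -> measurable_fun setT h ->
  (forall w, 0 <= g w <= h w) ->
  ('N[@area R]_p%:E[EFin \o g] <= 'N[@area R]_p%:E[EFin \o h])%E.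
Proof.
move=> mg mh gh.
have mX (k : R * R -> R) : measurable_fun setT k ->
    measurable_fun setT (fun w => (`|(EFin \o k) w| `^ p)%E).
  move=> mk; apply: (measurableT_comp (f := fun x => poweR x p)).
    exact: measurable_poweR.
  by apply: measurableT_comp => //; exact/measurable_EFinP.
rewrite unlock /Lnorm; apply: gt0_ler_poweR.
- by rewrite invr_ge0 ltW.
- by rewrite in_itv /= leey andbT integral_ge0 // => w _; exact: poweR_ge0.
- by rewrite in_itv /= leey andbT integral_ge0 // => w _; exact: poweR_ge0.
apply: ge0_le_integral => //= [||w _].
- exact: mX mg.
- exact: mX mh.
- have /andP[g0 ghw] := gh w.
  have h0 := le_trans g0 ghw.
  by rewrite !ger0_norm // lee_fin ge0_ler_powR ?nnegrE // ltW.
Qed.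

Let mass_addr f g w : 0 <= mass (f + g) w <= (mass f \+ mass g) w.
Proof.
rewrite mass_ge0 /= /mass !patchE; case: ifPn => _; last by rewrite addr0.
by rewrite -mulrDl ler_wpM2r ?powR_ge0 // rnormD.
Qed.

Let Lnorm_mass_addr f g : f \in bergman_set v p -> g \in bergman_set v p ->
  ('N[@area R]_p%:E[EFin \o mass (f + g)%R] <=
   'N[@area R]_p%:E[EFin \o mass f] + 'N[@area R]_p%:E[EFin \o mass g])%E.
Proof.
move=> fA gA; have cA h : h \in bergman_set v p -> measurable_fun setT (mass h).
  by move=> hA; apply: measurable_mass => z Dz; exact: (bergman_continuous hA).
have cfg : measurable_fun setT (mass (f + g)).
  apply: measurable_mass => z Dz.
  exact: continuousD (bergman_continuous fA Dz) (bergman_continuous gA Dz).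
apply: le_trans (le_Lnorm_mass cfg _ (mass_addr f g)) _.
  by apply: measurable_funD; exact: cA.
by apply: minkowski_EFin; rewrite ?ltW //; exact: cA.
Qed.

Lemma bergman_addr_closed f g :
  f \in bergman_set v p -> g \in bergman_set v p -> f + g \in bergman_set v p.
Proof.
move=> fA gA; have := Lnorm_mass_addr fA gA.
rewrite -(bergman_normE fA) -(bergman_normE gA) -EFinD.
move=> /le_lt_trans/(_ (ltry _)).
move/pintegral_lty => fgy; apply: mem_set.
case: (set_mem fA) (set_mem gA) => df f0 _ [dg g0 _]; split=> [z Dz|z nDz|].
- exact: derivableD (df z Dz) (dg z Dz).
- by have -> : (f + g) z = f z + g z by []; rewrite f0 // g0 // addr0.
- exact: fgy.
Qed.

Lemma ler_bergman_normD f g :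
  f \in bergman_set v p -> g \in bergman_set v p ->
  bergman_norm (f + g) <= bergman_norm f + bergman_norm g.
Proof.
move=> fA gA; have fgA := bergman_addr_closed fA gA.
have := Lnorm_mass_addr fA gA.
by rewrite -(bergman_normE fA) -(bergman_normE gA) -(bergman_normE fgA) -EFinD lee_fin.
Qed.

Let pintegralZ a f : f \in bergman_set v p ->
  (pintegral v p (a *: f) = (rnorm a `^ p)%:E * pintegral v p f)%E.
Proof.
move=> fA; rewrite /pintegral -ge0_integralZl_EFin ?powR_ge0 //.
- apply: eq_integral => w _.
  by rewrite -EFinM -!mulrA [(a *: f) _]/(a *: f (toC w)) rnormZ powRM ?rnorm_ge0 // !mulrA.
- exact: measurable_diskR2.
- move=> w Dw; rewrite lee_fin divr_ge0 ?pi_ge0 //.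
  by rewrite mulr_ge0 ?powR_ge0 // ltW // wfun_gt0.
- apply/measurable_EFinP; apply: measurable_funM; last exact: measurable_cst.
  apply: measurable_funM; last first.
    by apply: measurable_toC_continuous; exact: wfun_continuous.
  apply: (measurableT_comp (f := fun x : R => x `^ p)).
    exact: measurable_powR.
  apply: (measurable_toC_continuous (h := fun z => rnorm (f z))) => z Dz.
  apply: continuous_comp; first exact: bergman_continuous.
  exact: rnorm_continuous.
Qed.

Lemma bergman_scaler_closed a f :
  f \in bergman_set v p -> a *: f \in bergman_set v p.
Proof.
move=> fA; have afE := pintegralZ a fA; apply: mem_set.
case: (set_mem fA) => df f0 fy; split=> [z Dz|z Dz|].
- exact: derivableZ (df z Dz).
- by have -> : (a *: f) z = a * f z by []; rewrite f0 // mulr0.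
rewrite afE; move: fy (pintegral_ge0 f); case: (pintegral v p f) => // r _ _.
by rewrite -EFinM ltry.
Qed.

Lemma bergman_normZ a f : f \in bergman_set v p ->
  bergman_norm (a *: f) = rnorm a * bergman_norm f.
Proof.
move=> fA; rewrite /bergman_norm (pintegralZ _ fA).
rewrite fineM; [|by []|].
  rewrite /= powRM ?powR_ge0 ?fine_ge0 ?pintegral_ge0 //.
  by rewrite -powRrM mulfV ?gt_eqF // powRr1 // rnorm_ge0.
by rewrite ge0_fin_numE ?pintegral_ge0 //; case: (set_mem fA).
Qed.

Lemma bergman_norm_eq0 f : f \in bergman_set v p -> bergman_norm f = 0 -> f = 0.
Proof.
move=> fA nf0; apply/funext => z; have [Dz|nDz] := pselect (disk z); last first.
  by case: (set_mem fA) => _ -> .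
apply/eqP; apply: contrapT => /negP fz.
pose U : set R[i] := [set z | disk z /\ f z != 0].
have oU : open U.
  rewrite openE => t [Dt ft]; apply: filterI.
    by apply: open_nbhs_nbhs; split => //; exact: disk_open.
  exact: (cvgr_neq0 (f t) (bergman_continuous fA Dt)).
have Nf0 : ('N[@area R]_p%:E[EFin \o mass f] = 0)%E by rewrite -(bergman_normE fA) nf0.
have mf : measurable_fun setT (EFin \o mass f).
  apply/measurable_EFinP; apply: measurable_mass => t.
  exact: (bergman_continuous fA).
have p0E : (0 < p%:E)%E by rewrite lte_fin.
have ae0 := Lnorm_eq0_eq0 (mu := @area R) (f := EFin \o mass f) mf p0E Nf0.
have zE : toC (complex.Re z, complex.Im z) = z by case: (z).
have := @area_open_gt0 R U (complex.Re z, complex.Im z) oU.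
rewrite zE => /(_ (conj Dz fz)).
suff UN : (@area R).-negligible (@toC R @^-1` U).
  have U0 := measure_negligible (mu := @area R) (open_toC_measurable oU) UN.
  by move=> /lt_eqF; rewrite eq_sym => /eqP; apply; exact: U0.
apply: negligibleS ae0 => w [Dw fw] /= /(_ I) [] /eqP.
rewrite /mass patchE mem_set // mulf_eq0 (gt_eqF (dens_gt0 Dw)) orbF => /eqP.
by move/rnorm_eq0 => fw0; rewrite fw0 eqxx in fw.
Qed.

End bergman_lemmas.

Section bergman_type.
Variables (R : realType) (v : weight R) (p : R) (p1 : 1 < p).

Definition bergman_pred (_ : 1 < p) : {pred R[i] -> R[i]} :=
  mem (bergman_set v p).

Lemma bergman_submod_closed : submod_closed (bergman_pred p1).
Proof.
split=> [|a f g fA gA].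
  have -> : (0 : R[i] -> R[i]) = 0 *: 0 by rewrite scaler0.
  apply: mem_set; split=> [z _|z _|].
  - by rewrite scaler0; exact: derivable_cst.
  - by rewrite scaler0.
  - rewrite /pintegral scaler0 integral0_eq ?ltry // => w _.
    rewrite [(0 : R[i] -> R[i]) _]/(0 : R[i]) rnorm0 powR0 ?mul0r //.
    by rewrite gt_eqF // (lt_trans _ p1).
exact: (bergman_addr_closed p1 (bergman_scaler_closed a fA) gA).
Qed.

HB.instance Definition _ :=
  GRing.isSubmodClosed.Build R[i] (R[i] -> R[i]) (bergman_pred p1)
    bergman_submod_closed.

Record bergman := Bergman {
  bergman_fun :> R[i] -> R[i] ;
  _ : bergman_fun \in bergman_pred p1
}.

HB.instance Definition _ := [isSub for bergman_fun].
HB.instance Definition _ := [Choice of bergman by <:].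
HB.instance Definition _ := [SubChoice_isSubLmodule of bergman by <:].

Let nm (f : bergman) : R[i] := (bergman_norm v p f)%:C.

Let ler_nmD (f g : bergman) : nm (f + g) <= nm f + nm g.
Proof.
rewrite /nm -rmorphD /= lecR.
exact: (ler_bergman_normD p1 (valP f) (valP g)).
Qed.

Let nmZ a (f : bergman) : nm (a *: f) = `|a| * nm f.
Proof.
rewrite /nm (rnormE (a : R[i])) -rmorphM; congr (_%:C).
exact: (bergman_normZ p1 a (valP f)).
Qed.

Let nm_eq0 (f : bergman) : nm f = 0 -> f = 0.
Proof.
move=> /complexI f0; apply: val_inj.
exact: (bergman_norm_eq0 p1 (valP f) f0).
Qed.

HB.instance Definition _ :=
  Lmodule_isNormed.Build R[i] bergman ler_nmD nmZ nm_eq0.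

Lemma bergman_normrE (f : bergman) : `|f| = (bergman_norm v p f)%:C.
Proof. by []. Qed.

End bergman_type.

Arguments bergman {R} v {p} p1.

Section standing_assumptions.
Variables (R : realType) (v : weight R) (p : R) (p1 : 1 < p).

Definition delta (z : R[i]) (f : bergman v p1) : R[i] := f z.

Definition admissible : Prop :=
  [/\ forall z, disk z -> (opnorm (delta z) < +oo)%E,
      (\int[lebesgue_measure]_(s in `[0%R, 1%R[) opnorm (delta s%:C) < +oo)%E
    & reflexive_space (bergman v p1)].

End standing_assumptions.

(* Main.v *)
(** Let [f_n] be unit vectors with [|T f_n| -> |T|].  By reflexivity a
    subsequence converges weakly to some [f], hence pointwise since point
    evaluations are bounded; likewise [T f_n -> T f] pointwise.  If [f = 0] this
    is the first alternative.  Otherwise the Brezis-Lieb lemma, applied in both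
    spaces, gives [|f_n - f|^p -> 1 - |f|^p] and
    [|T f_n|^q - |T f_n - T f|^q -> |T f|^q].  As [p <= q],
    [|T (f_n - f)|^q <= |T|^q |f_n - f|^p] once [|f_n - f| <= 1], so
    [|T f|^q >= |T|^q |f|^p >= |T|^q |f|^q], and [f / |f|] attains the norm.

    Sequential weak compactness comes from ultrafilters: a bounded sequence has a
    weak limit along each ultrafilter because the limit functional lies in the
    bidual, and this limit is determined by its values at a countable dense set
    of points.  That weak convergence implies compact convergence follows from
    the uniform boundedness principle applied to the difference quotients
    [(delta_z - delta_z0) / (z - z0)]. *)

Require Import Defs.
From HB Require Import structures.
From mathcomp Require Import all_boot all_order all_algebra.
From mathcomp Require Import all_classical all_reals all_analysis.
From mathcomp Require Import measurable_realfun complex ring lra.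

Set Implicit Arguments.
Unset Strict Implicit.
Unset Printing Implicit Defensive.
Import Order.TTheory GRing.Theory Num.Theory numFieldNormedType.Exports.

Local Open Scope classical_set_scope.
Local Open Scope ring_scope.
Local Open Scope complex_scope.

(** * Elementary properties of the real-valued norm *)

Lemma rnormN (R : realType) (W : normedModType R[i]) (x : W) : rnorm (- x) = rnorm x.
Proof. by rewrite /rnorm normrN. Qed.

Lemma rnormB (R : realType) (W : normedModType R[i]) (x y : W) :
  rnorm x - rnorm y <= rnorm (x - y).
Proof. by rewrite lerBlDr; apply: le_trans (rnormD _ _); rewrite subrK. Qed.

Lemma rnorm_gt0 (R : realType) (W : normedModType R[i]) (x : W) :
  (0 < rnorm x) = (x != 0).
Proof.
rewrite lt_neqAle rnorm_ge0 eq_sym andbT; congr (~~ _).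
by apply/eqP/eqP => [/rnorm_eq0|->]; last exact: rnorm0.
Qed.

(** * Ultrafilter limits *)

Lemma rnorm_real (R : realType) (a : R) : rnorm (a%:C : R[i]) = `|a|.
Proof. by rewrite /rnorm normc_def /= expr0n /= addr0 sqrtr_sqr. Qed.

Lemma cvg_rnormP (R : realType) (V : normedModType R[i]) (T : Type)
    (F : set_system T) (FF : Filter F) (f : T -> V) (l : V) :
  f x @[x --> F] --> l <->
  forall e : R, 0 < e -> \forall x \near F, rnorm (f x - l) < e.
Proof.
split=> [/cvgrPdist_lt h e e0|h].
  have e0C : 0 < e%:C by rewrite ltcR.
  by apply: filterS (h _ e0C) => x; rewrite distrC rnormE ltcR.
apply/cvgrPdist_lt => e; case: e => a b; rewrite ltcE /= => /andP[/eqP -> a0].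
by apply: filterS (h _ a0) => x; rewrite distrC rnormE ltcR.
Qed.

(** Compactness of [-M, M] gives a cluster point. It is a limit, since otherwise the ultrafilter
    would contain the preimage of the complement of some neighbourhood, which the cluster point
    forbids. *)
Lemma bounded_ultra_cvg (R : realType) (T : Type) (U : set_system T)
    (UU : UltraFilter U) (c : T -> R) (M : R) :
  (forall n, `|c n| <= M) -> exists l : R, c n @[n --> U] --> l.
Proof.
move=> cM; have PU : ProperFilter U by exact: ultra_proper.
have [|l [_ cl]] := @segment_compact R (- M) M (c @ U) (fmap_proper_filter c PU).
  by apply: (@filterE _ U) => n /=; rewrite in_itv /= -ler_norml.
exists l => N Nl; have [//|UN] := in_ultra_setVsetC (c @^-1` N) UU.
have [y [Ny nNy]] := cl (~` N) N UN Nl.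
by [].
Qed.

Lemma rnorm_le_ReIm (R : realType) (z : R[i]) :
  rnorm z <= `|complex.Re z| + `|complex.Im z|.
Proof.
rewrite -lecR -(rnormE (z : R[i])) [z in `|z|]complexE.
apply: le_trans (ler_normD _ _) _; rewrite normrM !normc_def /=.
by rewrite !expr0n /= expr1n !addr0 add0r sqrtr1 mul1r !sqrtr_sqr -rmorphD.
Qed.

Lemma Re_le_rnorm (R : realType) (z : R[i]) : `|complex.Re z| <= rnorm z.
Proof.
case: z => a b; rewrite /rnorm normc_def /= -sqrtr_sqr.
by rewrite ler_wsqrtr // lerDl sqr_ge0.
Qed.

Lemma Im_le_rnorm (R : realType) (z : R[i]) : `|complex.Im z| <= rnorm z.
Proof.
case: z => a b; rewrite /rnorm normc_def /= -sqrtr_sqr.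
by rewrite ler_wsqrtr // lerDr sqr_ge0.
Qed.

Lemma bounded_ultra_cvgC (R : realType) (T : Type) (U : set_system T)
    (UU : UltraFilter U) (c : T -> R[i]) (M : R) :
  (forall n, rnorm (c n) <= M) -> exists l : R[i], c n @[n --> U] --> l.
Proof.
move=> cM; have PU : ProperFilter U by exact: ultra_proper.
have [a ca] := bounded_ultra_cvg UU (fun n => le_trans (Re_le_rnorm (c n)) (cM n)).
have [b cb] := bounded_ultra_cvg UU (fun n => le_trans (Im_le_rnorm (c n)) (cM n)).
exists (a +i* b); apply/cvg_rnormP => e e0.
have e20 : 0 < e / 2 by rewrite divr_gt0.
have ha : \forall n \near U, `|a - complex.Re (c n)| < e / 2.
  exact: cvgr_dist_lt.
have hb : \forall n \near U, `|b - complex.Im (c n)| < e / 2.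
  exact: cvgr_dist_lt.
near=> n; apply: le_lt_trans (rnorm_le_ReIm _) _.
have -> : c n - (a +i* b) = (complex.Re (c n) - a) +i* (complex.Im (c n) - b).
  by case: (c n) => x y; simpc.
rewrite /= [ltRHS]splitr (distrC _ a) (distrC _ b).
by apply: ltrD; near: n.
Unshelve. all: by end_near. Qed.

(** If the preimage of a neighbourhood [N] of [l] is not in [F], then [F] restricted to the points
    sent outside [N] is still proper, and an ultrafilter above it contradicts the hypothesis. *)
Lemma ultra_cvg (R : realType) (V : normedModType R[i]) (T : Type)
    (F : set_system T) (FF : ProperFilter F) (f : T -> V) (l : V) :
  (forall U, UltraFilter U -> F `<=` U -> f x @[x --> U] --> l) ->
  f x @[x --> F] --> l.
Proof.
move=> h N Nl; apply: contrapT => FN.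
pose B := [set x | ~ N (f x)].
have PB : ProperFilter (within B F).
  apply: Build_ProperFilter_ex => P /= BP.
  apply: contrapT => nP; apply: FN; have {}BP : \forall x \near F, B x -> P x by [].
  apply: filterS BP => x BPx /=.
  by apply: contrapT => Bx; apply: nP; exists x; exact: BPx.
have [U [UU BU]] := ultraFilterLemma PB.
have FU : F `<=` U by move=> P FP; apply: BU; apply: filterS FP.
have PU : ProperFilter U by exact: ultra_proper.
have UB : U B by apply: BU; apply: (@filterE _ F).
have UN : U (f @^-1` N) by exact: (h U UU FU).
by have [x [/= Bx Nx]] := filter_ex (filterI UB UN).
Qed.

Lemma ultra_oo : exists2 U : set_system nat, UltraFilter U & \oo `<=` U.
Proof. by have [U []] := ultraFilterLemma (F := \oo) _; exists U. Qed.

(** * Reflexive spaces *)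

Section reflexive.
Variables (R : realType) (V : normedModType R[i]).

Lemma opnorm_ge0 (W : normedModType R[i]) (F : V -> W) : (0 <= opnorm F)%E.
Proof.
apply: (@le_trans _ _ (rnorm (F 0))%:E); first by rewrite lee_fin rnorm_ge0.
by apply: ereal_sup_ubound; exists 0 => //=; rewrite rnorm0.
Qed.

Lemma opnorm_fin_num (W : normedModType R[i]) (F : V -> W) :
  (opnorm F < +oo)%E -> opnorm F \is a fin_num.
Proof. by move=> h; rewrite ge0_fin_numE // opnorm_ge0. Qed.

Lemma opnorm_ball (W : normedModType R[i]) (F : V -> W) x :
  (opnorm F < +oo)%E -> rnorm x <= 1 -> rnorm (F x) <= fine (opnorm F).
Proof.
move=> hF x1; rewrite -lee_fin fineK ?opnorm_fin_num //.
by apply: ereal_sup_ubound; exists x.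
Qed.

Lemma rnormV1 (x : V) : x != 0 -> rnorm ((rnorm x)^-1%:C *: x) = 1.
Proof.
move=> x0; rewrite rnormZ rnorm_real ger0_norm ?invr_ge0 ?rnorm_ge0 //.
by rewrite mulVf // gt_eqF // rnorm_gt0.
Qed.

Lemma le_opnorm (W : normedModType R[i]) (F : V -> W) x : linear F ->
  (opnorm F < +oo)%E -> rnorm (F x) <= fine (opnorm F) * rnorm x.
Proof.
move=> lF hF; pose F' : {linear V -> W} :=
  HB.pack F (GRing.isLinear.Build _ _ _ _ F lF).
have [->|x0] := eqVneq x 0.
  by rewrite -[F 0]/(F' 0) linear0 !rnorm0 mulr0.
have x0' : 0 < rnorm x by rewrite rnorm_gt0.
rewrite -ler_pdivrMr // mulrC -[X in X * _](gtr0_norm _) ?invr_gt0 //.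
rewrite -rnorm_real -rnormZ -[F x]/(F' x) -linearZ.
by apply: opnorm_ball => //; rewrite rnormV1.
Qed.

Lemma opnorm_le (W : normedModType R[i]) (F : V -> W) (M : R) :
  (forall x, rnorm x <= 1 -> rnorm (F x) <= M) -> (opnorm F <= M%:E)%E.
Proof. by move=> h; apply: ge_ereal_sup => _ [x x1 <-]; rewrite lee_fin h. Qed.

Hypothesis reflV : reflexive_space V.

Lemma reflexive_ultra_weak_cvg (T : Type) (U : set_system T)
    (UU : UltraFilter U) (u : T -> V) :
  (forall n, rnorm (u n) <= 1) ->
  exists x, forall phi, dual phi -> phi (u n) @[n --> U] --> phi x.
Proof.
move=> u1; have PU : ProperFilter U by exact: ultra_proper.
(* Off [dual] the limit may fail to exist and [lim] is a default value; reflexivity tests [Psi] only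
   on [dual]. *)
pose Psi (phi : V -> R[i]) : R[i] := lim (phi (u n) @[n --> U]).
have cPsi phi : dual phi -> phi (u n) @[n --> U] --> Psi phi.
  move=> [_ phioo].
  have [l ul] := bounded_ultra_cvgC UU (fun n => opnorm_ball phioo (u1 n)).
  by apply/cvg_ex; exists l.
have [| |x xP] := reflV (Psi := Psi).
- move=> a phi psi dphi dpsi; apply/cvg_lim; first exact: norm_hausdorff.
  apply: cvgD; last exact: cPsi.
  by apply: cvgZr; exact: cPsi.
- exists 1 => phi dphi; rewrite mul1e.
  have [_ phioo] := dphi.
  rewrite -(fineK (opnorm_fin_num phioo)) lee_fin.
  have h : rnorm (phi (u n)) @[n --> U] --> rnorm (Psi phi).
    by apply: continuous_cvg; [exact: rnorm_continuous|exact: cPsi].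
  rewrite -(cvg_lim _ h) //; apply: limr_le; first by apply/cvg_ex; eexists; exact: h.
  by apply: nearW => n; exact: opnorm_ball.
by exists x => phi dphi; rewrite -xP //; exact: cPsi.
Qed.

(* Every weak ultrafilter limit of [u] agrees with [x] on the separating family
   [d], hence is [x]. *)
Lemma separating_weak_cvg (I : Type) (d : I -> V -> R[i]) (u : nat -> V) (x : V) :
  (forall i, dual (d i)) -> (forall y, (forall i, d i y = d i x) -> y = x) ->
  (forall n, rnorm (u n) <= 1) ->
  (forall i, d i (u n) @[n --> \oo] --> d i x) -> weak_cvg u x.
Proof.
move=> dd dsep u1 du phi dphi; apply: ultra_cvg => U UU ooU.
have PU : ProperFilter U by exact: ultra_proper.
have [y yP] := reflexive_ultra_weak_cvg UU u1.
suff <- : y = x by exact: yP.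
apply: dsep => i; apply: (@cvg_unique _ _ (d i (u n) @[n --> U])).
- exact: norm_hausdorff.
- exact: yP.
- by move=> N /du; exact: ooU.
Qed.

End reflexive.

Section reflexive_sequences.
Variables (R : realType) (V : normedModType R[i]).
Hypothesis reflV : reflexive_space V.

(** A diagonal choice: finitely many sets of an ultrafilter meet, so some n >= k brings the
    functionals with code below k within 1/(k+1) of their values at the ultrafilter limit. The
    selection [s] tends to infinity but need not be monotone. *)
Lemma weak_cvg_subseq (I : countType) (d : I -> V -> R[i]) (u : nat -> V) :
  (forall i, dual (d i)) -> (forall x y, (forall i, d i y = d i x) -> y = x) ->
  (forall n, rnorm (u n) <= 1) ->
  exists x (s : nat -> nat), (forall k, (k <= s k)%N) /\ weak_cvg (u \o s) x.
Proof.
move=> dd dsep u1; have [U UU ooU] := ultra_oo.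
have PU : ProperFilter U by exact: ultra_proper.
have [x ux] := reflexive_ultra_weak_cvg reflV UU u1.
have /choice[s sP] (k : nat) : exists n, (k <= n)%N /\
    forall (j : 'I_k) i, unpickle j = Some i ->
      rnorm (d i (u n) - d i x) < k.+1%:R^-1.
  have Uk : U [set n | (k <= n)%N] by apply: ooU; exists k.
  have Ud : \forall n \near U, forall (j : 'I_k), if unpickle j is Some i then
      rnorm (d i (u n) - d i x) < k.+1%:R^-1 else true.
    apply: filter_forall => j; case: unpickle => [i|]; last exact: nearW.
    have := ux _ (dd i); move/cvg_rnormP; apply.
    by rewrite invr_gt0.
  have [n [kn nd]] := filter_ex (filterI Uk Ud).
  by exists n; split=> // j i ji; have := nd j; rewrite ji.
exists x, s; split=> [k|]; first by have [] := sP k.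
apply: (separating_weak_cvg reflV dd) => // [y|n|i].
- exact: dsep.
- exact: u1.
apply/cvg_rnormP => e e0.
near=> k; have ik : (pickle i < k)%N by near: k; exact: nbhs_infty_gt.
have [_ /(_ (Ordinal ik) i (pickleK i))] := sP k.
move=> /lt_trans; apply; near: k; exact: (near_infty_natSinv_lt (PosNum e0)).
Unshelve. all: by end_near. Qed.

(* Sokal's gliding hump: adding [b k] or [- b k] to the previous term keeps
   [phi k] large at the new one, and the later increments are too small to
   destroy this. *)
Section gliding_hump.
Variable phi : nat -> V -> R[i].
Hypothesis dphi : forall k, dual (phi k).
Let N k := fine (opnorm (phi k)).
Hypothesis phi_large : forall k, 4 * 3 ^+ k.+1 * k%:R < N k.
Variable h : nat -> V.
Hypothesis h1 : forall k, rnorm (h k) <= 1.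
Hypothesis hN : forall k, 3 / 4 * N k <= rnorm (phi k (h k)).

Let b k : V := (3 ^- k.+1)%:C *: h k.

Fixpoint hump k : V := if k is k'.+1 then
  let x := hump k' in
  if rnorm (phi k' (b k')) <= rnorm (phi k' (x + b k')) then x + b k' else x - b k'
  else 0.

Let phiD k x y : phi k (x + y) = phi k x + phi k y.
Proof. by have [lphi _] := dphi k; rewrite -[x]scale1r lphi !scale1r. Qed.

Let phiZ k a x : phi k (a *: x) = a * phi k x.
Proof.
have [lphi _] := dphi k.
have phi0 : phi k 0 = 0 by apply: (addrI (phi k 0)); rewrite -phiD !addr0.
by rewrite -[a *: x]addr0 lphi phi0 addr0.
Qed.

Let phiN k x : phi k (- x) = - phi k x.
Proof. by rewrite -scaleN1r phiZ mulN1r. Qed.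

Let rnorm_b k : rnorm (b k) <= 3 ^- k.+1.
Proof.
rewrite rnormZ rnorm_real ger0_norm ?invr_ge0 ?exprn_ge0 //.
by rewrite ler_piMr // invr_ge0 exprn_ge0.
Qed.

Let rnorm_phib k : rnorm (phi k (b k)) = 3 ^- k.+1 * rnorm (phi k (h k)).
Proof.
by rewrite phiZ [_ * _]/(_ *: _) rnormZ rnorm_real ger0_norm // invr_ge0 exprn_ge0.
Qed.

(** The values of [phi k] at x + b and x - b differ by 2 [phi k] b, so at least one of them has
    modulus at least that of [phi k] b. *)
Lemma hump_large k : 3 ^- k.+1 * (3 / 4 * N k) <= rnorm (phi k (hump k.+1)).
Proof.
apply: (@le_trans _ _ (rnorm (phi k (b k)))).
  by rewrite rnorm_phib ler_pM2l // invr_gt0 exprn_gt0.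
rewrite /=; case: ifPn => //; rewrite -ltNge => lt.
have : rnorm ((phi k (hump k + b k) - phi k (hump k - b k)) : R[i]) =
    2 * rnorm (phi k (b k)).
  rewrite -phiN -phiD opprB addrC subrKA phiD.
  rewrite -mulr2n -[_ *+ 2]mulr_natl -(rmorph_nat (real_complex R)).
  by rewrite [_ * _]/(_ *: _) rnormZ rnorm_real normr_nat.
have := rnormD (phi k (hump k + b k)) (- phi k (hump k - b k)).
rewrite rnormN => /[swap] -> le.
rewrite -(lerD2r (rnorm (phi k (b k)))) -mulr2n -[_ *+ 2]mulr_natl.
by apply: le_trans le _; rewrite addrC lerD2l ltW.
Qed.

(** The j-th increment has norm at most 3^-(j+1); the bound is the geometric sum over k <= j < k +
    m. *)
Lemma hump_cauchy k m : rnorm (hump (k + m) - hump k) <= 2^-1 * (3 ^- k - 3 ^- (k + m)).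
Proof.
elim: m => [|m IH]; first by rewrite addn0 !subrr rnorm0 mulr0.
have step : rnorm (hump (k + m.+1) - hump (k + m)) <= 3 ^- (k + m).+1.
  rewrite addnS /=; case: ifP => _; first by rewrite addrC addKr.
  by rewrite addrC addKr rnormN.
have -> : hump (k + m.+1) - hump k =
  (hump (k + m.+1) - hump (k + m)) + (hump (k + m) - hump k) by rewrite addrA subrK.
apply: le_trans (rnormD _ _) _; apply: le_trans (lerD step IH) _.
rewrite addnS [in leLHS]exprS [in leRHS](exprS _ (k + m)) !invfM.
set c := (_ ^- (k + m)); set c' := _ ^- k.
by lra.
Qed.

(** Reflexivity stands in for completeness: the humps have a weak ultrafilter limit. For n > k, the
    increments after [hump k.+1] cost at most half of 3^-(k+1) [N k] out of the three quarters in
    [hump_large], and the remaining quarter exceeds k by [phi_large]. *)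
Lemma hump_limit : exists x, forall k, k%:R <= rnorm (phi k x).
Proof.
have hump1 k : rnorm (hump k) <= 1.
  have := hump_cauchy 0 k; rewrite add0n subr0 => /le_trans; apply.
  have : 0 <= 3 ^- k :> R by rewrite invr_ge0 exprn_ge0.
  by rewrite expr0 invr1; move: (3 ^- k) => c c0; lra.
have [U UU ooU] := ultra_oo.
have PU : ProperFilter U by exact: ultra_proper.
have [x ux] := reflexive_ultra_weak_cvg reflV UU hump1.
exists x => k.
have hk : rnorm (phi k (hump n)) @[n --> U] --> rnorm (phi k x).
  by apply: continuous_cvg; [exact: rnorm_continuous|exact: ux].
apply: (cvgr_to_ge hk); apply: ooU; exists k.+1 => // n /= kn.
have -> : hump n = hump k.+1 + (hump n - hump k.+1) by rewrite addrC subrK.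
rewrite phiD; set y := hump n - _.
have yk : rnorm y <= 2^-1 * 3 ^- k.+1.
  rewrite /y -(subnKC kn); apply: le_trans (hump_cauchy _ _) _.
  by rewrite ler_pM2l ?invr_gt0 // gerBl invr_ge0 exprn_ge0.
have [lphi phioo] := dphi k.
have py : rnorm (phi k y) <= N k * (2^-1 * 3 ^- k.+1).
  apply: le_trans (le_opnorm _ lphi phioo) _; apply: ler_wpM2l => //.
  by rewrite fine_ge0 // opnorm_ge0.
have := rnormB (phi k (hump k.+1)) (- phi k y); rewrite opprK rnormN.
apply: le_trans.
have hl := hump_large k.
have kN : 4 * k%:R < 3 ^- k.+1 * N k.
  by rewrite ltr_pdivlMl ?exprn_gt0 // mulrA [_ * 4]mulrC.
move: hl py kN; move: (3 ^- k.+1) (N k) (rnorm _) (rnorm _) (k%:R).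
move=> c l a e j; rewrite mulrCA [l * _]mulrCA [l * c]mulrC => hl py kN.
by lra.
Qed.

End gliding_hump.

(** The uniform boundedness principle in contrapositive form, with the growth of the norms
    prescribed so that no subsequence has to be extracted. *)
Lemma gliding_hump (phi : nat -> V -> R[i]) : (forall k, dual (phi k)) ->
  (forall k, ((4 * 3 ^+ k.+1 * k%:R)%:E < opnorm (phi k))%E) ->
  exists x, forall k, k%:R <= rnorm (phi k x).
Proof.
move=> dphi large.
have fphi k : opnorm (phi k) \is a fin_num.
  by have [_ /opnorm_fin_num] := dphi k.
have large' k : 4 * 3 ^+ k.+1 * k%:R < fine (opnorm (phi k)).
  by rewrite -lte_fin fineK.
(* Near-maximisers in the unit ball exist because the norm of [phi k] is positive, hence larger than
   three quarters of itself. *)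
have /choice[h hP] k : exists h, rnorm h <= 1 /\
    3 / 4 * fine (opnorm (phi k)) <= rnorm (phi k h).
  have : ((3 / 4 * fine (opnorm (phi k)))%:E < opnorm (phi k))%E.
    rewrite -[ltRHS]fineK // lte_fin gtr_pMl; first by lra.
    by apply: le_lt_trans (large' k); rewrite mulr_ge0 // mulr_ge0 // exprn_ge0.
  by case/ereal_sup_gt => _ [y y1 <-]; rewrite lte_fin => /ltW; exists y.
by apply: (@hump_limit phi dphi large' h) => k; have [] := hP k.
Qed.

End reflexive_sequences.

(** * Weak and compact convergence in Bergman spaces *)

Section bergman_topology.
Variables (R : realType) (v : weight R) (p : R) (p1 : 1 < p).
Hypothesis Ap : admissible v p1.
Let A := bergman v p1.

Lemma bergman_out (f : A) z : ~ disk z -> f z = 0.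
Proof. by have [_ + _] := set_mem (valP f); exact. Qed.

Lemma bergman_linE a (f g : A) z : (a *: f + g) z = a * f z + g z.
Proof. by []. Qed.

Lemma dual_delta z : dual (@delta R v p p1 z).
Proof.
split=> //; have [Dz|nDz] := pselect (disk z).
  by have [+ _ _] := Ap; exact.
apply: (@le_lt_trans _ _ 0%:E); last exact: ltry.
by apply: opnorm_le => f _; rewrite /delta bergman_out // rnorm0.
Qed.

(** Otherwise difference quotients at points tending to [z0] form functionals whose norms grow as
    fast as [gliding_hump] requires. The resulting function has unbounded difference quotients at
    [z0], although it is differentiable there. *)
Lemma delta_lipschitz z0 : disk z0 -> exists2 r : R, 0 < r &
  exists2 M : R, 0 <= M & forall z (f : A), rnorm (z - z0) < r ->
    rnorm (f z - f z0) <= M * rnorm (z - z0) * rnorm f.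
Proof.
move=> Dz0; apply: contrapT => nL.
have [_ _ reflA] := Ap.
have /choice[zf zfP] (k : nat) : exists zf : R[i] * A,
    rnorm (zf.1 - z0) < k.+1%:R^-1 /\
    4 * 3 ^+ k.+1 * k%:R * rnorm (zf.1 - z0) * rnorm zf.2 <
      rnorm (zf.2 zf.1 - zf.2 z0).
  (* The radius shrinks so that the bad points tend to [z0]; the Lipschitz constant is the growth
     rate in [gliding_hump]. *)
  apply: contrapT => nk; apply: nL; exists k.+1%:R^-1; first by rewrite invr_gt0.
  exists (4 * 3 ^+ k.+1 * k%:R) => [|z f zk].
    by rewrite mulr_ge0 // mulr_ge0 // exprn_ge0.
  rewrite leNgt; apply/negP => h.
  by apply: nk; exists (z, f).
pose dz k := (zf k).1 - z0.
(* At [z0] itself both sides of the strict inequality would vanish. *)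
have dz0 k : dz k != 0.
  have [_] := zfP k; apply: contraPneq => /eqP; rewrite subr_eq0 => /eqP ->.
  by rewrite !subrr !rnorm0 mulr0 mul0r ltxx.
pose phi k (f : A) : R[i] := (dz k)^-1 * (f (zf k).1 - f z0).
have dphi k : dual (phi k).
  split.
    move=> a f g; rewrite /phi !bergman_linE.
    rewrite -[RHS]/(a * ((dz k)^-1 * (f (zf k).1 - f z0)) +
      (dz k)^-1 * (g (zf k).1 - g z0)); ring.
  have [_ o1] := dual_delta (zf k).1; have [_ o2] := dual_delta z0.
  apply: (@le_lt_trans _ _ (rnorm (dz k)^-1 *
    (fine (opnorm (@delta R v p p1 (zf k).1)) +
     fine (opnorm (@delta R v p p1 z0))))%:E); last exact: ltry.
  apply: opnorm_le => f f1; rewrite /phi [_ * _]/(_ *: _) rnormZ.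
  apply: ler_wpM2l; first exact: rnorm_ge0.
  apply: le_trans (rnormD _ _) _; rewrite rnormN.
  by apply: lerD; [exact: (opnorm_ball o1 f1)|exact: (opnorm_ball o2 f1)].
have [|x xP] := gliding_hump reflA dphi.
  move=> k; have [lphi phioo] := dphi k; have [_ h] := zfP k.
  rewrite -(fineK (opnorm_fin_num phioo)) lte_fin ltNge; apply/negP => le.
  have := le_opnorm (zf k).2 lphi phioo.
  rewrite leNgt => /negP; apply.
  apply: (@le_lt_trans _ _ (4 * 3 ^+ k.+1 * k%:R * rnorm (zf k).2)).
    by apply: ler_wpM2r => //; exact: rnorm_ge0.
  have nz : 0 < rnorm (dz k) by rewrite rnorm_gt0.
  have phiE : (zf k).2 (zf k).1 - (zf k).2 z0 = dz k * phi k (zf k).2.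
    by rewrite /phi mulrA divff // mul1r.
  rewrite phiE [dz k * _]/(dz k *: _) rnormZ in h.
  by rewrite -(ltr_pM2l nz) mulrCA mulrA.
have [dx _ _] := set_mem (valP x).
have := dx z0 Dz0; rewrite /derivable => /cvg_ex[l xl].
have dzl : phi k x @[k --> \oo] --> l.
  have dz0' : dz k @[k --> \oo] --> 0^'.
    have dzo : dz k @[k --> \oo] --> (0 : R[i]).
      apply/cvg_rnormP => e e0; near=> k; rewrite subr0.
      have [h _] := zfP k; apply: lt_trans h _.
      by near: k; exact: (near_infty_natSinv_lt (PosNum e0)).
    move=> N /= /dzo Ndz; have {}Ndz : \forall k \near \oo, dz k != 0 -> N (dz k) := Ndz.
    by apply: filterS Ndz => k; apply; exact: dz0.
  have -> : (fun k => phi k x) =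
      (fun h : R[i] => h^-1 *: (x (h *: 1 + z0) - x z0)) \o dz.
    apply/funext => k /=; rewrite /phi; congr (_ * (x _ - _)).
    by rewrite /dz [_ *: 1]mulr1 subrK.
  exact: cvg_comp dz0' xl.
have rl : rnorm (phi k x) @[k --> \oo] --> rnorm l.
  by apply: continuous_cvg; [exact: rnorm_continuous|exact: dzl].
have : \forall k \near \oo, rnorm (phi k x) < rnorm l + 1.
  by apply: (cvgr_lt _ rl); rewrite ltrDl.
move=> h.
have : \forall k \near \oo, rnorm l + 1 < k%:R by exact: nbhs_infty_gtr.
move=> /(filterI h) /filter_ex[k [/= h1 h2]].
by have := le_lt_trans (xP k) (lt_trans h1 h2); rewrite ltxx.
Unshelve. all: by end_near. Qed.

(** By [delta_lipschitz] the unit ball is equicontinuous at each point of the disk, so pointwise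
    convergence is locally uniform, hence uniform on compact sets. *)
Lemma weak_compact_cvg (f : nat -> A) : (forall n, rnorm (f n) <= 1) ->
  weak_cvg f 0 -> compact_cvg (fun n => f n) 0.
Proof.
move=> f1 f0; apply/fam_cvgP => K [cK KD] P /uniform_nbhs[E [entE EP]].
move: entE; rewrite -entourage_ballE => -[e /= e0 eE].
suff : \forall n \near \oo, K `<=` [set z | ball (0 : R[i]) e (f n z)].
  by apply: filterS => n Kn; apply: EP => z Kz; apply: eE => /=; exact: Kn.
apply: (iffLR (compact_near_coveringP K)) => // z Kz.
case: e e0 {eE} => b c; rewrite ltcE /= => /andP[/eqP -> b0].
have [r r0 [M M0 fM]] := delta_lipschitz (KD z Kz).
have M1 : 0 < M + 1 by rewrite ltr_wpDl.
(* Within this radius the oscillation of every [f n] is below b/2. The bound [M] may be zero, whence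
   M + 1. *)
have d0 : 0 < Num.min r (b / 2 / (M + 1)).
  by rewrite lt_min r0 !divr_gt0.
have fz : \forall n \near \oo, rnorm (f n z) < b / 2.
  have /cvg_rnormP/(_ (b / 2)) := f0 _ (dual_delta z).
  by rewrite divr_gt0 // => /(_ isT); apply: filterS => n; rewrite subr0.
have zz : \forall y \near z, rnorm (y - z) < Num.min r (b / 2 / (M + 1)).
  by have /cvg_rnormP := @cvg_id _ (nbhs z); apply.
near=> y n => /=.
rewrite -ball_normE /= sub0r normrN rnormE ltcR.
have -> : f n y = (f n y - f n z) + f n z by rewrite subrK.
apply: le_lt_trans (rnormD _ _) _; rewrite [ltRHS]splitr.
have : rnorm (y - z) < Num.min r (b / 2 / (M + 1)) by near: y.
rewrite lt_min => /andP[yr yb].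
apply: ltr_leD; last by apply: ltW; near: n.
apply: le_lt_trans (fM _ _ yr) _.
apply: (@le_lt_trans _ _ ((M + 1) * rnorm (y - z))).
  apply: le_trans (ler_piMr _ (f1 n)) _; first by rewrite mulr_ge0 ?rnorm_ge0.
  by rewrite ler_wpM2r ?rnorm_ge0 // lerDl.
by rewrite mulrC -ltr_pdivlMr.
Unshelve. all: by end_near. Qed.

(** Singletons are compact, so the convergence is pointwise, and the point evaluations are a
    separating family. *)
Lemma compact_weak_cvg (f : nat -> A) : (forall n, rnorm (f n) <= 1) ->
  compact_cvg (fun n => f n) 0 -> weak_cvg f 0.
Proof.
move=> f1 cf; have [_ _ reflA] := Ap.
apply: (separating_weak_cvg reflA dual_delta) => // [g|z].
  by move=> g0; apply: val_inj; apply/funext => z; exact: g0.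
have [Dz|nDz] := pselect (disk z); last first.
  rewrite /delta bergman_out //; under eq_fun do rewrite bergman_out //.
  exact: cvg_cst.
apply/cvg_rnormP => e e0.
have /fam_cvgP/(_ [set z]) := cf.
have zK : compact [set z] /\ [set z] `<=` @disk R.
  by split; [exact: compact_set1|move=> _ ->].
move=> /(_ zK) /(_ [set h | ball (0 : R[i]) e%:C (h z)]) h.
have : \forall n \near \oo, ball (0 : R[i]) e%:C (f n z).
  apply: h; apply/uniform_nbhs; exists [set xy | ball xy.1 e%:C xy.2].
  split; last by move=> g; apply.
  by rewrite -entourage_ballE; exists e%:C => //=; rewrite ltcR.
apply: filterS => n; rewrite -ball_normE /= sub0r normrN rnormE ltcR.
by rewrite [X in _ - X]/(0 : R[i]) subr0.
Qed.

End bergman_topology.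

(** * Countably many separating point evaluations *)

Section separation.
Variables (R : realType) (v : weight R) (p : R) (p1 : 1 < p).
Let A := bergman v p1.

Let ratC (i : rat * rat) : R[i] := toC (ratr i.1, ratr i.2).

Lemma open_rat_point (U : set R[i]) z : open U -> U z -> exists i, U (ratC i).
Proof.
move=> oU Uz; have [|r r0 rU] := @open_toC_square R U (complex.Re z, complex.Im z) oU.
  by rewrite /toC /=; case: z Uz.
have ratnear (x : R) : exists a : rat, `|x - ratr a| < r.
  have [a] : exists a : rat, ratr a \in `](x - r), (x + r)[.
    by apply: rat_in_itvoo; rewrite ltrD2l gtrN.
  by rewrite in_itv /= -ltr_distl => xa; exists a; rewrite distrC.
have [a xa] := ratnear (complex.Re z); have [b yb] := ratnear (complex.Im z).
by exists (a, b); exact: rU.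
Qed.

(** The points of the disk where f - g does not vanish form an open set; if nonempty, it would
    contain a rational point. *)
Lemma bergman_rat_inj (f g : A) : (forall i, f (ratC i) = g (ratC i)) -> f = g.
Proof.
move=> fg; apply: subr0_eq; apply: val_inj; apply/funext => z.
have [Dz|nDz] := pselect (disk z); last exact: (bergman_out (f - g) nDz).
apply: contrapT => /eqP hz.
pose h := f - g.
have oU : open [set z | disk z /\ h z != 0].
  rewrite openE => t [Dt ht]; apply: filterI.
    by apply: open_nbhs_nbhs; split => //; exact: disk_open.
  have ch : h u @[u --> t] --> h t := bergman_continuous (valP h) Dt.
  exact: (cvgr_neq0 (h t) ch ht).
have [i [_ /eqP]] := open_rat_point oU (conj Dz hz).
have hi : h (ratC i) = f (ratC i) - g (ratC i) by [].
by apply; rewrite hi fg subrr.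
Qed.

Lemma bergman_weak_subseq (u : nat -> A) : admissible v p1 ->
  (forall n, rnorm (u n) <= 1) ->
  exists x (s : nat -> nat), (forall k, (k <= s k)%N) /\ weak_cvg (u \o s) x.
Proof.
move=> Ap u1; have [_ _ reflA] := Ap.
apply: (weak_cvg_subseq reflA (d := fun i => @delta R v p p1 (ratC i))) => //.
- by move=> i; exact: dual_delta.
- by move=> x y; exact: bergman_rat_inj.
Qed.

End separation.

(** * The Brezis-Lieb lemma *)

Lemma powR_le_cancel (R : realType) (p a b : R) : 0 < p -> 0 <= a -> 0 <= b ->
  a `^ p <= b `^ p -> a <= b.
Proof.
move=> p0 a0 b0; rewrite !leNgt; apply: contra => ba.
by apply: gt0_ltr_powR; rewrite ?nnegrE.
Qed.

(** Smallness is asked of a^p because the Brezis-Lieb limit controls that power. *)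
Lemma powR_exp_le (R : realType) (p q a : R) : 0 < p -> p <= q -> 0 <= a ->
  a `^ p <= 1 -> a `^ q <= a `^ p.
Proof.
move=> p0 pq; rewrite le_eqVlt => /predU1P[<- _|a0 ap].
  by rewrite !powR0 ?gt_eqF // (lt_le_trans p0).
apply: ger_powR => //; rewrite a0 /=.
apply: (powR_le_cancel p0) => //; first exact: ltW.
by rewrite [leRHS](congr1 (@^~ p) (powR1 R)).
Qed.

(** Choose d with (1 + d)^p = 1 + e. If t <= d s the first term suffices; otherwise s + t <= (1 +
    1/d) t, and C = (1 + 1/d)^p. *)
Lemma powRD_le (R : realType) (p e : R) : 0 < p -> 0 < e ->
  exists C : R, forall s t : R, 0 <= s -> 0 <= t ->
    (s + t) `^ p <= (1 + e) * s `^ p + C * t `^ p.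
Proof.
move=> p0 e0; pose d := (1 + e) `^ p^-1 - 1.
have d0 : 0 < d.
  rewrite subr_gt0 -[ltLHS](congr1 (fun f => f p^-1) (@powR1 R)).
  by apply: gt0_ltr_powR; rewrite ?invr_gt0 ?nnegrE ?ltrDl // addr_ge0 // ltW.
have d0' := ltW d0; have e0' := ltW e0; have p0' := ltW p0.
have dE : (1 + d) `^ p = 1 + e.
  by rewrite /d addrC subrK -powRrM mulVf ?gt_eqF // powRr1 // addr_ge0.
have d1 : 0 <= 1 + d^-1 by rewrite addr_ge0 // invr_ge0.
have d2 : 0 <= 1 + d by rewrite addr_ge0.
clearbody d; exists ((1 + d^-1) `^ p) => s t s0 t0.
have [tds|/ltW dst] := leP t (d * s).
  apply: (@le_trans _ _ ((1 + e) * s `^ p)); last first.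
    by rewrite lerDl mulr_ge0 ?powR_ge0.
  rewrite -dE -powRM //.
  apply: ge0_ler_powR => //; rewrite ?nnegrE.
  - exact: addr_ge0.
  - exact: mulr_ge0.
  by rewrite mulrDl mul1r lerD2l.
apply: (@le_trans _ _ ((1 + d^-1) `^ p * t `^ p)); last first.
  by rewrite lerDr mulr_ge0 ?powR_ge0 // addr_ge0.
rewrite -powRM //; apply: ge0_ler_powR => //; rewrite ?nnegrE.
- exact: addr_ge0.
- exact: mulr_ge0.
by rewrite mulrDl mul1r addrC lerD2l -ler_pdivrMl ?invr_gt0 // invrK.
Qed.

Lemma limn_einf_gt (R : realType) (a : nat -> \bar R) (l : \bar R) :
  (l < limn_einf a)%E -> \forall n \near \oo, (l < a n)%E.
Proof.
rewrite limn_einf_lim => h.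
have : einfs a n @[n --> \oo] --> ereal_sup (range (einfs a)).
  exact: ereal_nondecreasing_cvgn (nondecreasing_einfs a).
move=> /cvg_lim => /(_ (@ereal_hausdorff R)) E; rewrite E in h.
have [_ [k _ <-] lk] := ereal_sup_gt h.
exists k => // n /= kn; apply: lt_le_trans lk _.
by apply: ereal_inf_lbound; exists n.
Qed.

(** For l > 0 the power is differentiable at l; the limit 0 is treated by hand. *)
Lemma cvg_powR (R : realType) (T : Type) (F : set_system T) (FF : Filter F)
    (f : T -> R) (l p : R) : 0 < p -> 0 <= l -> (forall x, 0 <= f x) ->
  f x @[x --> F] --> l -> (f x `^ p) @[x --> F] --> l `^ p.
Proof.
move=> p0; rewrite le_eqVlt => /predU1P[<- f0 fl|l0 f0 fl].
  rewrite powR0 ?gt_eqF //; apply/cvgrPdist_lt => e e0.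
  have d0 : 0 < e `^ p^-1 by rewrite powR_gt0.
  have := @cvgr_dist_lt _ _ _ _ FF _ _ fl _ d0.
  apply: filterS => x; rewrite !sub0r !normrN.
  rewrite !ger0_norm ?powR_ge0 // => h.
  rewrite -[e](powRr1 (ltW e0)) -(@mulVf _ p) ?gt_eqF // powRrM.
  by apply: gt0_ltr_powR; rewrite ?nnegrE ?powR_ge0.
apply: (@continuous_cvg _ _ _ F FF f (fun x => x `^ p)) => //.
apply: differentiable_continuous; apply/derivable1_diffP.
by apply: derivable_powR; rewrite in_itv /= l0.
Qed.

Lemma ltr_cancel_middle (R : realFieldType) (a b c d k l : R) :
  a + c - b - l < d + c - k -> a - b - l < d - k.
Proof. by lra. Qed.

Lemma distr_lt_of_both (R : realFieldType) (a b c d eta : R) :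
  a - b - eta < c - d -> b - a - eta < d - c -> `|(a - b) - (c - d)| < eta.
Proof. by move=> h1 h2; rewrite ltr_distl; apply/andP; split; lra. Qed.

(** Removes the factor 1 + e from the Fatou inequality: e c <= eta / 2 is charged to the error, and
    e a >= 0 is dropped. *)
Lemma absorb_error (R : realFieldType) (a b c d e m eta : R) :
  e * (m + 1) = eta / 2 -> 0 < e -> 0 <= a -> c <= m ->
  (1 + e) * a - b - eta / 2 < (1 + e) * c - d -> a - b - eta < c - d.
Proof.
move=> eE e0 a0 cm; have ea : 0 <= e * a by rewrite mulr_ge0 // ltW.
have ec : e * c <= e * m by rewrite ler_pM2l.
by move: eE; rewrite mulrDr mulr1 !mulrDl !mul1r => eE h; lra.
Qed.

Section brezis_lieb.
Variables (R : realType) (v : weight R) (p : R) (p1 : 1 < p).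
Let A := bergman v p1.

Let p0 : 0 < p. Proof. exact: lt_trans p1. Qed.

Let dens (f : A) (w : R * R) : \bar R :=
  (rnorm (f (toC w)) `^ p * v (toC w) / pi)%:E.

Let measurable_dens f : measurable_fun (@diskR2 R) (dens f).
Proof.
apply/measurable_EFinP; apply: measurable_funM; last exact: measurable_cst.
apply: measurable_funM; last first.
  by apply: measurable_toC_continuous; exact: wfun_continuous.
apply: (measurableT_comp (f := fun x : R => x `^ p)).
  exact: measurable_powR.
apply: (measurable_toC_continuous (h := fun z => rnorm (f z))) => z Dz.
apply: continuous_comp; first exact: bergman_continuous (valP f) Dz.
exact: rnorm_continuous.
Qed.

Let weight_ge0 w : diskR2 w -> 0 <= v (toC w) / pi.
Proof. by move=> Dw; rewrite divr_ge0 ?pi_ge0 // ltW // wfun_gt0. Qed.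

Let dens_ge0 f w : diskR2 w -> (0 <= dens f w)%E.
Proof.
by move=> Dw; rewrite lee_fin -mulrA mulr_ge0 ?powR_ge0 // weight_ge0.
Qed.

Lemma rnorm_powR (f : A) : (rnorm f `^ p)%:E = pintegral v p f.
Proof.
have [_ _ foo] := set_mem (valP f).
have f0 := pintegral_ge0 v p f.
rewrite /rnorm bergman_normrE /= /bergman_norm -powRrM mulVf ?gt_eqF //.
by rewrite powRr1 ?fine_ge0 // fineK // ge0_fin_numE.
Qed.

Let integrable_dens f : (@area R).-integrable (@diskR2 R) (dens f).
Proof.
apply/integrableP; split; first exact: measurable_dens.
have [_ _ foo] := set_mem (valP f).
apply: le_lt_trans foo; rewrite le_eqVlt; apply/orP; left; apply/eqP.
by apply: eq_integral => w; rewrite inE => Dw; rewrite gee0_abs // dens_ge0.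
Qed.

(* Fatou's lemma for [(1 + e) |u n|^p + C |h|^p - |u n + h|^p >= 0]. *)
Lemma rnorm_powR_ge (u : nat -> A) (x h : A) (e C : R) :
  (forall s t : R, 0 <= s -> 0 <= t ->
    (s + t) `^ p <= (1 + e) * s `^ p + C * t `^ p) ->
  (forall z, disk z -> u n z @[n --> \oo] --> x z) ->
  forall eta, 0 < eta -> \forall n \near \oo,
    (1 + e) * rnorm x `^ p - rnorm (x + h) `^ p - eta <
    (1 + e) * rnorm (u n) `^ p - rnorm (u n + h) `^ p.
Proof.
move=> eC ux eta eta0.
pose G (f : A) w := ((1 + e)%:E * dens f w + C%:E * dens h w - dens (f + h)%R w)%E.
have mD := @measurable_diskR2 R.
have intG f : (\int[@area R]_(w in @diskR2 R) G f w =
    ((1 + e) * rnorm f `^ p + C * rnorm h `^ p - rnorm (f + h) `^ p)%:E)%E.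
  have iZ k g : (@area R).-integrable (@diskR2 R) (fun w => k%:E * dens g w)%E.
    by apply: integrableZl; [exact: mD|exact: integrable_dens].
  have iD : (@area R).-integrable (@diskR2 R)
      (fun w => (1 + e)%:E * dens f w + C%:E * dens h w)%E.
    by apply: integrableD; [exact: mD|exact: iZ|exact: iZ].
  rewrite (integralB _ iD (integrable_dens _)); last exact: mD.
  rewrite (integralD _ (iZ _ _) (iZ _ _)); last exact: mD.
  rewrite !(integralZl _ (integrable_dens _)); [|exact: mD..].
  have IE g : (\int[@area R]_(w in @diskR2 R) dens g w = (rnorm g `^ p)%:E)%E.
    by rewrite rnorm_powR.
  by rewrite !IE.
(* Once the density v / pi is factored out, this is [eC] after the triangle inequality. *)
have G0 f w : diskR2 w -> (0 <= G f w)%E.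
  move=> Dw; rewrite /G /dens -!EFinM -!EFinD lee_fin.
  have -> : forall a b c d V : R, (1 + e) * (a * V / d) + C * (b * V / d) -
      c * V / d = ((1 + e) * a + C * b - c) * (V / d) by move=> *; ring.
  rewrite mulr_ge0 ?weight_ge0 // subr_ge0.
  apply: le_trans (eC _ _ (rnorm_ge0 _) (rnorm_ge0 _)).
  by apply: ge0_ler_powR; rewrite ?nnegrE ?addr_ge0 ?rnorm_ge0 ?rnormD // ltW.
have mG n : measurable_fun (@diskR2 R) (G (u n)).
  apply: emeasurable_funB; last exact: measurable_dens.
  by apply: emeasurable_funD; apply: measurable_funeM; exact: measurable_dens.
have limG w : diskR2 w -> limn_einf (fun n => G (u n) w) = G x w.
  move=> Dw.
  have cdens (y : nat -> A) (z : A) : y n (toC w) @[n --> \oo] --> z (toC w) ->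
      rnorm (y n (toC w)) `^ p * v (toC w) / pi @[n --> \oo] -->
      rnorm (z (toC w)) `^ p * v (toC w) / pi.
    move=> yz; apply: cvgMl; apply: cvgMl.
    apply: cvg_powR => //; first exact: rnorm_ge0.
      by move=> n; exact: rnorm_ge0.
    by apply: continuous_cvg yz; exact: rnorm_continuous.
  suff Gx : G (u n) w @[n --> \oo] --> G x w by rewrite (cvg_limn_einf_sup Gx).1.
  rewrite /G /dens -!EFinM -!EFinD.
  under eq_fun do rewrite -!EFinM -!EFinD.
  apply: cvg_EFin; first exact: nearW.
  apply: cvgB; last by apply: cdens; apply: cvgD; [exact: ux|exact: cvg_cst].
  apply: cvgD; last exact: cvg_cst.
  by apply: cvgMr; apply: cdens; exact: ux.
have le_liminf : (\int[@area R]_(w in @diskR2 R) G x w <=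
    limn_einf (fun n => \int[@area R]_(w in @diskR2 R) G (u n) w))%E.
  have := fatou (@area R) mD mG (fun n => G0 (u n)).
  apply: le_trans; rewrite le_eqVlt; apply/orP; left; apply/eqP.
  by apply: eq_integral => w; rewrite inE => Dw; rewrite limG.
rewrite intG in le_liminf.
(* Lowering the bound by [eta] makes it strict, hence valid for all large n; the term with [C] is
   common to both sides and cancels. *)
have /limn_einf_gt : (((1 + e) * rnorm x `^ p + C * rnorm h `^ p -
    rnorm (x + h) `^ p - eta)%:E <
    limn_einf (fun n => \int[@area R]_(w in @diskR2 R) G (u n) w))%E.
  by apply: lt_le_trans le_liminf; rewrite lte_fin gtrBl.
apply: filterS => n; rewrite intG lte_fin.
exact: ltr_cancel_middle.
Qed.

(** Half of [eta] pays for Fatou's lemma, the other half for e |u n|^p. The choice e (M^p + 1) = eta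
    / 2 also makes sense for M = 0. *)
Lemma brezis_lieb_half (u : nat -> A) (x h : A) (M : R) :
  (forall z, disk z -> u n z @[n --> \oo] --> x z) ->
  (forall n, rnorm (u n) <= M) ->
  forall eta, 0 < eta -> \forall n \near \oo,
    rnorm x `^ p - rnorm (x + h) `^ p - eta <
    rnorm (u n) `^ p - rnorm (u n + h) `^ p.
Proof.
move=> ux uM eta eta0.
have M0 : 0 <= M by exact: le_trans (rnorm_ge0 _) (uM 0).
have e0 : 0 < eta / 2 / (M `^ p + 1).
  by rewrite !divr_gt0 // ltr_wpDl ?powR_ge0.
have [C eC] := powRD_le p0 e0.
have e20 : 0 < eta / 2 by rewrite divr_gt0.
have := rnorm_powR_ge h eC ux e20; apply: filterS => n.
have : rnorm (u n) `^ p <= M `^ p.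
  by apply: ge0_ler_powR; rewrite ?nnegrE ?rnorm_ge0 // ltW.
have := powR_ge0 (rnorm x) p; have := powR_ge0 M p.
move: e0; set e := (eta / 2 / _) => e0.
have eE : e * (M `^ p + 1) = eta / 2.
  by rewrite /e divfK // gt_eqF // ltr_wpDl ?powR_ge0.
clearbody e => m0 x0 unM h1.
exact: (absorb_error eE _ _ _ h1).
Qed.

(** The one-sided bound for [u] and [h] gives one inequality; the same bound for [u n + h] and [- h]
    gives the reverse one. *)
Lemma brezis_lieb (u : nat -> A) (x h : A) (M : R) :
  (forall z, disk z -> u n z @[n --> \oo] --> x z) ->
  (forall n, rnorm (u n) <= M) ->
  rnorm (u n) `^ p - rnorm (u n + h) `^ p @[n --> \oo] -->
  rnorm x `^ p - rnorm (x + h) `^ p.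
Proof.
move=> ux uM.
have uhx z : disk z -> (u n + h) z @[n --> \oo] --> (x + h) z.
  by move=> Dz; apply: cvgD; [exact: ux|exact: cvg_cst].
have uhM n : rnorm (u n + h) <= M + rnorm h.
  by apply: le_trans (rnormD _ _) _; rewrite lerD2r.
apply/cvgrPdist_lt => eta eta0.
have H1 := brezis_lieb_half h ux uM eta0.
have H2 := brezis_lieb_half (- h) uhx uhM eta0.
apply: filterS2 H1 H2 => n.
rewrite (addrK h x) (addrK h (u n)); exact: distr_lt_of_both.
Qed.

Lemma brezis_lieb_sub (u : nat -> A) (x : A) (M : R) :
  (forall z, disk z -> u n z @[n --> \oo] --> x z) ->
  (forall n, rnorm (u n) <= M) ->
  rnorm (u n) `^ p - rnorm (u n - x) `^ p @[n --> \oo] --> rnorm x `^ p.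
Proof.
move=> ux uM; have xx : rnorm (x - x) `^ p = 0.
  by rewrite (subrr x) rnorm0 powR0 // gt_eqF.
rewrite -[X in _ --> X]subr0 -xx.
exact: brezis_lieb ux uM.
Qed.

End brezis_lieb.

(** * Extremal sequences *)

Section extremal.
Variables (R : realType) (V W : normedModType R[i]) (T : {linear V -> W}).
Hypothesis Tb : (opnorm T < +oo)%E.

Lemma opnorm_unit_approx (a : R) : 0 < fine (opnorm T) -> a < fine (opnorm T) ->
  exists x, rnorm x = 1 /\ a < rnorm (T x).
Proof.
move=> T0 aT.
(* The maximum with 0 forces T y, hence y, to be nonzero, so y can be normalised; since |y| <= 1
   this only increases |T y|. *)
have : ((Num.max 0 a)%:E < opnorm T)%E.
  by rewrite -[ltRHS]fineK ?opnorm_fin_num // lte_fin gt_max T0.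
case/ereal_sup_gt => _ [y /= y1 <-]; rewrite lte_fin gt_max => /andP[Ty ay].
have y0 : y != 0.
  by apply: contraTneq Ty => ->; rewrite linear0 rnorm0 ltxx.
have ny : 0 < rnorm y by rewrite rnorm_gt0.
exists ((rnorm y)^-1%:C *: y); split; first exact: rnormV1.
apply: lt_le_trans ay _.
rewrite linearZ rnormZ rnorm_real ger0_norm ?invr_ge0 ?(ltW ny) //.
by rewrite ler_peMl ?rnorm_ge0 // invf_ge1.
Qed.

Lemma opnorm_attained x : x != 0 -> fine (opnorm T) * rnorm x <= rnorm (T x) ->
  exists y, rnorm y = 1 /\ (rnorm (T y))%:E = opnorm T.
Proof.
move=> x0 Tx; have nx : 0 < rnorm x by rewrite rnorm_gt0.
exists ((rnorm x)^-1%:C *: x); split; first exact: rnormV1.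
rewrite -(fineK (opnorm_fin_num Tb)); congr (_%:E); apply/eqP.
rewrite eq_le; apply/andP; split; first by apply: opnorm_ball; rewrite ?rnormV1.
rewrite linearZ rnormZ rnorm_real ger0_norm ?invr_ge0 ?(ltW nx) //.
by rewrite mulrC ler_pdivlMr.
Qed.

Lemma le_opnorm_sub (y x : V) : rnorm (T y - T x) <= fine (opnorm T) * rnorm (y - x).
Proof. by rewrite -linearB; apply: le_opnorm Tb => a z z'; exact: linearP. Qed.

End extremal.

(** * Extremal sequences with a nonzero weak limit *)

Section dichotomy.
Variables (R : realType) (v : weight R) (p q : R) (p1 : 1 < p) (q1 : 1 < q).
Hypotheses (pq : p <= q) (Ap : admissible v p1) (Aq : admissible v q1).
Variable T : {linear bergman v p1 -> bergman v q1}.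
Hypothesis Tb : (opnorm T < +oo)%E.

(** The conclusion is homogeneous because [x] need not be a unit vector; [opnorm_attained]
    normalises it. *)
Lemma weak_limit_attains (g : nat -> bergman v p1) (x : bergman v p1) :
  (forall n, rnorm (g n) = 1) -> weak_cvg g x -> x != 0 ->
  rnorm (T (g n)) @[n --> \oo] --> fine (opnorm T) ->
  fine (opnorm T) * rnorm x <= rnorm (T x).
Proof.
set t := fine (opnorm T) => g1 gx x0 Tg.
have p0 : 0 < p by exact: lt_trans p1.
have q0 : 0 < q by exact: lt_trans q1.
have t0 : 0 <= t by rewrite fine_ge0 // opnorm_ge0.
have gz z : disk z -> g n z @[n --> \oo] --> x z.
  by move=> _; exact: (gx (delta z) (dual_delta Ap z)).
(* Evaluation at z after [T] is itself a bounded functional on the source space. *)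
have Tgz z : disk z -> T (g n) z @[n --> \oo] --> T x z.
  move=> _; apply: (gx (fun y => T y z) _); split.
    by move=> a y y'; rewrite linearP.
  have [dl db] := dual_delta Aq z.
  apply: (@le_lt_trans _ _ (fine (opnorm (@delta R v q q1 z)) * t)%:E).
    apply: opnorm_le => y y1; apply: le_trans (le_opnorm (T y) dl db) _.
    by apply: ler_wpM2l; [rewrite fine_ge0 ?opnorm_ge0|exact: opnorm_ball].
  exact: ltry.
have gle1 n : rnorm (g n) <= 1 by rewrite g1.
have Tgle n : rnorm (T (g n)) <= t by exact: opnorm_ball.
set X := rnorm x `^ p.
have X0 : 0 < X by rewrite powR_gt0 // rnorm_gt0.
have aX : rnorm (g n - x) `^ p @[n --> \oo] --> 1 - X.
  have h := brezis_lieb_sub gz gle1.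
  have -> : (fun n => rnorm (g n - x) `^ p) =
      (fun n => 1 - (rnorm (g n) `^ p - rnorm (g n - x) `^ p)).
    apply/funext => n; rewrite g1 (congr1 (@^~ p) (powR1 R)).
    by rewrite opprB addrCA subrr addr0.
  by apply: cvgB h; exact: cvg_cst.
have bT := brezis_lieb_sub Tgz Tgle.
have X1 : X <= 1.
  rewrite -subr_ge0; apply: (cvgr_to_ge aX); apply: nearW => n; exact: powR_ge0.
have tX : t `^ q * X <= rnorm (T x) `^ q.
  have lo : rnorm (T (g n)) `^ q - t `^ q * rnorm (g n - x) `^ p @[n --> \oo] -->
      t `^ q - t `^ q * (1 - X).
    apply: cvgB; first by apply: cvg_powR => // n; exact: rnorm_ge0.
    by apply: cvgMr.
  rewrite mulrBr mulr1 opprB addrCA subrr addr0 in lo.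
  apply: (ler_cvg_to lo bT).
  (* Here [x != 0] enters: the limit 1 - X is below 1, so the exponent p may be replaced by the
     larger q. *)
  have : \forall n \near \oo, rnorm (g n - x) `^ p < 1.
    by apply: (cvgr_lt _ aX); rewrite gtrBl.
  apply: filterS => n gx1; rewrite lerD2l lerN2.
  apply: (@le_trans _ _ ((t * rnorm (g n - x)) `^ q)).
    apply: ge0_ler_powR; rewrite ?nnegrE ?rnorm_ge0 ?mulr_ge0 ?rnorm_ge0 ?(ltW q0) //.
    exact: (le_opnorm_sub Tb (g n) x).
  rewrite powRM ?rnorm_ge0 //; apply: ler_wpM2l; first exact: powR_ge0.
  exact: (powR_exp_le p0 pq (rnorm_ge0 _) (ltW gx1)).
apply: (powR_le_cancel q0).
- exact: mulr_ge0 t0 (rnorm_ge0 _).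
- exact: rnorm_ge0.
rewrite (powRM _ t0 (rnorm_ge0 _)); apply: le_trans tX.
apply: ler_wpM2l; first exact: powR_ge0.
exact: (powR_exp_le p0 pq (rnorm_ge0 _) X1).
Qed.

End dichotomy.

Theorem theorem9p3 (R : realType) (v : weight R) (p q : R)
  (p1 : 1 < p) (q1 : 1 < q) (pq : p <= q)
  (Ap : admissible v p1) (Aq : admissible v q1)
  (T : {linear bergman v p1 -> bergman v q1}) (Tb : (opnorm T < +oo)%E) :
  (forall f : nat -> bergman v p1, (forall n, `|f n| = 1) ->
     (weak_cvg f 0 <-> compact_cvg (fun n => f n) 0)) /\
  ((exists f : nat -> bergman v p1,
      [/\ forall n, `|f n| = 1,
          weak_cvg f 0
        & (rnorm (T (f n)))%:E @[n --> \oo] --> opnorm T])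
   \/
   (exists f : bergman v p1,
      `|f| <= 1 /\ (rnorm (T f))%:E = opnorm T)).
Proof.
split=> [f f1|].
  have fle n : rnorm (f n) <= 1 by rewrite /rnorm f1.
  by split; [exact: weak_compact_cvg|exact: compact_weak_cvg].
have T0 : 0 <= fine (opnorm T) by rewrite fine_ge0 ?opnorm_ge0.
have Tfin := opnorm_fin_num Tb.
(* If the operator norm is 0, the zero function attains it; otherwise unit vectors can approximate
   it. *)
move: T0; rewrite le_eqVlt => /predU1P[T0|T0].
  right; exists 0; rewrite normr0 linear0 rnorm0; split; first exact: ler01.
  by rewrite T0 fineK.
have /choice[f fP] (n : nat) : exists f : bergman v p1, rnorm f = 1 /\
    fine (opnorm T) - n.+1%:R^-1 < rnorm (T f).
  by apply: opnorm_unit_approx => //; rewrite gtrBl invr_gt0.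
have f1 n : rnorm (f n) = 1 by have [] := fP n.
have [|x [s [sk fx]]] := @bergman_weak_subseq _ _ _ _ f Ap.
  by move=> n; rewrite f1.
(* Since n <= s n, the error 1/(s n + 1) is at most 1/(n + 1), even if [s] is not monotone. *)
have gT : rnorm (T (f (s n))) @[n --> \oo] --> fine (opnorm T).
  apply/cvgrPdist_lt => e e0; near=> n.
  have [_ fn] := fP (s n).
  rewrite ger0_norm ?subr_ge0 ?opnorm_ball ?f1 //.
  rewrite ltrBlDr -ltrBlDl; apply: le_lt_trans fn; rewrite lerD2l lerN2.
  apply: (@le_trans _ _ n.+1%:R^-1).
    by rewrite lef_pV2 ?posrE // ler_nat ltnS.
  by near: n; apply: filterS (near_infty_natSinv_lt (PosNum e0)) => n /ltW.
have [x0|x0] := eqVneq x 0.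
  left; exists (f \o s); split=> [n||].
  - by rewrite rnormE f1.
  - by rewrite -x0.
  - rewrite -(fineK Tfin); apply: cvg_EFin; first exact: nearW.
    exact: gT.
right.
have := weak_limit_attains pq Ap Aq Tb (fun n => f1 (s n)) fx x0 gT.
move=> /(opnorm_attained Tb x0)[y [y1 Ty]].
by exists y; rewrite rnormE y1.
Unshelve. all: by end_near. Qed.
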